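(* Let $R\subseteq\mathbb{R}^n$ be an irreducible root system of rank $n$ and of type $A$, $D$, or $E$. The quadratic form $Q[H]=\sum_{x\in R}H[x]^2$ on the space $\mathcal{S}^n$ of symmetric $n\times n$ matrices has the following eigenvalues (listed with multiplicities): - $R=A_n$, $n\ge1$: $4h=4(n+1)$ with multiplicity $1$; and, for $n\ge2$, $2(n+1)$ with multiplicity $n$ and $4$ with multiplicity $n(n-1)/2-1$; - $R=D_n$, $n\ge4$: $4h=8(n-1)$ with multiplicity $1$; $4(n-2)$ with multiplicity $n-1$; $8$ with multiplicity $n(n-1)/2$; - $R=E_6$: $4h=48$ with multiplicity $1$; $12$ with multiplicity $20$; - $R=E_7$: $4h=72$ with multiplicity $1$; $16$ with multiplicity $27$; - $R=E_8$: $4h=120$ with multiplicity $1$; $24$ with multiplicity $35$.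
   Context: Notation: $H[x]=x^{\mathsf T}Hx$. $\mathcal{S}^n$ carries the inner product $\langle A,B\rangle=\mathrm{Tr}(AB)$, and the eigenvalues of $Q$ are those of the Gram matrix of the bilinear form $b_Q(G,H)=\sum_{x\in R}G[x]H[x]$ with respect to an orthonormal basis of $\mathcal{S}^n$. All roots have squared norm $2$: $A_n=\{\pm(e_i-e_j):1\le i<j\le n+1\}$, regarded as a subset of $(1,\dots,1)^\perp\cong\mathbb{R}^n$; $D_n=\{\pm(e_i\pm e_j):1\le i<j\le n\}$; $E_8=D_8\cup\{\frac12(\pm e_1\pm\dots\pm e_8)\text{ with an even number of minus signs}\}$; $E_7=E_8\cap(e_7-e_8)^\perp$; $E_6=E_7\cap(e_6-e_7)^\perp$, each regarded in the Euclidean space it spans. $h=|R|/n$ is the Coxeter number. When listed values coincide (for $D_4$, $4(n-2)=8$) their multiplicities add; a listed value with multiplicity $0$ (for $A_2$, the value $4$) does not occur. *)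

(* Defs.v *)
From mathcomp Require Import all_boot all_order all_algebra.

Set Implicit Arguments.
Unset Strict Implicit.
Unset Printing Implicit Defensive.

Import Order.TTheory GRing.Theory Num.Theory.
Local Open Scope ring_scope.

Section RootForms.
Variable F : rcfType.

Definition dotc (n : nat) (x y : 'cV[F]_n) : F := (x^T *m y) 0 0.

(* H[x] *)
Definition qeval (n : nat) (H : 'M[F]_n) (x : 'cV[F]_n) : F :=
  (x^T *m H *m x) 0 0.

Definition symv (n : nat) : {vspace 'M[F]_n} :=
  fixedSpace (linfun (@trmx F n n)).

Lemma mem_symv (n : nat) (H : 'M[F]_n) : (H \in symv n) = (H^T == H).
Proof. by apply/fixedSpaceP/eqP; rewrite lfunE. Qed.

Definition orthonormal_basis (n m : nat) (E : m.-tuple 'M[F]_n) : Prop :=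
  basis_of (symv n) E /\
  forall i j : 'I_m, \tr (tnth E i *m tnth E j) = (i == j)%:R.

Definition Qform (n : nat) (R : seq 'cV[F]_n) (H : 'M[F]_n) : F :=
  \sum_(x <- R) qeval H x ^+ 2.

Definition bQ (n : nat) (R : seq 'cV[F]_n) (G H : 'M[F]_n) : F :=
  \sum_(x <- R) qeval G x * qeval H x.

Lemma bQ_diag (n : nat) (R : seq 'cV[F]_n) (H : 'M[F]_n) :
  bQ R H H = Qform R H.
Proof. by []. Qed.

Definition gram (n m : nat) (R : seq 'cV[F]_n) (E : m.-tuple 'M[F]_n) :
  'M[F]_m := \matrix_(i, j) bQ R (tnth E i) (tnth E j).

(* [s] lists pairs (value, multiplicity).  Multiplicities of coinciding values
   add up, and pairs with multiplicity 0 are irrelevant. *)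
Definition Q_eigenvalues (n : nat) (R : seq 'cV[F]_n) (s : seq (F * nat)) :
  Prop :=
  forall (m : nat) (E : m.-tuple 'M[F]_n), orthonormal_basis E ->
    char_poly (gram R E) = \prod_(p <- s) ('X - p.1%:P) ^+ p.2.

(* |R| / n; this is h when [R] is duplicate-free of rank [n]. *)
Definition coxeter_number (n : nat) (R : seq 'cV[F]_n) : F :=
  (size R)%:R / n%:R.

(* Indices are 0-based: [bvec i] is e_(i+1). *)
Definition bvec (N : nat) (i : 'I_N) : 'cV[F]_N := delta_mx i 0.

Definition rootA (n : nat) (y : 'cV[F]_n.+1) : Prop :=
  exists (i j : 'I_n.+1) (a : bool),
    (i < j)%N /\ y = (-1) ^+ a *: (bvec i - bvec j).

Definition rootD (n : nat) (y : 'cV[F]_n) : Prop :=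
  exists (i j : 'I_n) (a b : bool),
    (i < j)%N /\ y = (-1) ^+ a *: (bvec i + (-1) ^+ b *: bvec j).

(* In the half-integral vectors, [s] is the set of positions of minus signs. *)
Definition rootE8 (y : 'cV[F]_8) : Prop :=
  rootD y \/
  exists2 s : {set 'I_8}, ~~ odd #|s| &
    y = \col_(i < 8) ((-1) ^+ (i \in s) / 2%:R).

Definition rootE7 (y : 'cV[F]_8) : Prop :=
  rootE8 y /\ dotc y (bvec (inord 6) - bvec (inord 7)) = 0.

Definition rootE6 (y : 'cV[F]_8) : Prop :=
  rootE7 y /\ dotc y (bvec (inord 5) - bvec (inord 6)) = 0.

(* [R], a finite subset of F^n, is the standard system [P] of F^N regarded in
   the n-dimensional Euclidean space it spans: some linear isometric embedding
   [B] of F^n into F^N maps [R] onto [P]. *)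
Definition is_system (N n : nat) (P : 'cV[F]_N -> Prop) (R : seq 'cV[F]_n) :
  Prop :=
  uniq R /\
  exists2 B : 'M[F]_(N, n), B^T *m B = 1%:M &
    forall y : 'cV[F]_N, P y <-> exists2 x, x \in R & y = B *m x.

End RootForms.

(* Main.v *)
Require Import Defs.
From mathcomp Require Import all_boot all_order all_algebra ring lra zify.

(* Conjugating by the isometry B turns the sum over R into a sum over the
   explicit vectors y of the ambient space. There b_Q(G, H) always takes the
   form c tr(GH) + sum_ij M_ij tr(G S_i) tr(H S_j) for a few symmetric matrices S_i:
   the pulled-back diagonal units for types A and D, the identity alone for E6,
   E7, E8, whose roots form a design of strength 4. By Parseval the Gram matrix
   is then c + U M U^T with U^T U = W = (tr(S_i S_j)), so that Sylvester's
   determinant identity reduces its characteristic polynomial to that of M W,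
   which is always of the form a + b J with J the all-ones matrix.
   The second moment sum y y^T = 2h p is used twice: B B^T fixes its columns,
   which identifies B B^T with the orthogonal projection p, and its trace gives
   |R| = h n. *)

Set Implicit Arguments.
Unset Strict Implicit.
Unset Printing Implicit Defensive.

Import Order.TTheory GRing.Theory Num.Theory.
Local Open Scope ring_scope.

(** * Determinants *)

(** Sylvester's identity, kept free of division so that it holds over polynomials. Both sides equal
    [\det K * x ^+ p]: clearing [U] from the left gives one determinant, clearing it from the right
    gives the other. *)
Lemma det_scalar_sub_mulmx (R : comNzRingType) (m p : nat) (x : R)
    (U : 'M[R]_(m, p)) (V : 'M[R]_(p, m)) :
  \det (x%:M - U *m V) * x ^+ p = x ^+ m * \det (x%:M - V *m U).
Proof.
pose K := block_mx x%:M U V 1%:M.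
have detK : \det K = \det (x%:M - U *m V).
  have /(congr1 determinant) :
      block_mx 1%:M (- U) 0 1%:M *m K = block_mx (x%:M - U *m V) 0 V 1%:M.
    rewrite mulmx_block !mul1mx !mul0mx !add0r mulNmx.
    by congr block_mx; rewrite mulmx1 subrr.
  by rewrite det_mulmx det_ublock det_lblock !det1 !mul1r mulr1.
have /(congr1 determinant) :
    K *m block_mx 1%:M (- U) 0 x%:M = block_mx x%:M 0 V (x%:M - V *m U).
  rewrite mulmx_block !mulmx1 !mulmx0 !addr0 !mulmxN mul1mx mul_scalar_mx.
  by rewrite mul_mx_scalar addNr addrC.
by rewrite det_mulmx det_ublock det_lblock !det1 mul1r !det_scalar detK.
Qed.

(** A constant matrix is a column times a row, so Sylvester's identity reduces the determinant to
    size 1; [x != 0] serves to cancel the surplus factor [x]. *)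
Lemma det_scalar_sub_const (R : idomainType) (p : nat) (x b : R) :
  x != 0 ->
  \det (x%:M - const_mx b : 'M[R]_p.+1) = x ^+ p * (x - b *+ p.+1).
Proof.
move=> x0; apply: (mulIf x0).
have -> : const_mx b = (const_mx b : 'cV_p.+1) *m const_mx 1 :> 'M[R]_p.+1.
  apply/matrixP=> i j; rewrite !mxE (eq_bigr (fun _ : 'I_1 => b)).
    by rewrite sumr_const card_ord.
  by move=> k _; rewrite !mxE mulr1.
rewrite -[X in _ * X]expr1 det_scalar_sub_mulmx.
rewrite det_mx11 !mxE eqxx mulr1n exprSr -!mulrA; congr (_ * _).
rewrite mulrC; congr (( _ - _) * _).
under eq_bigr do rewrite !mxE mul1r.
by rewrite sumr_const card_ord.
Qed.

(** Sylvester's identity in the variable X - c exchanges U M U^T for M U^T U = a + b J. Powers of X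
    - c stay on both sides because [m] may be smaller than [p.+1], as happens for A_1. *)
Lemma char_poly_scalar_add (F : fieldType) (m p : nat) (a b c : F)
    (U : 'M[F]_(m, p.+1)) (M : 'M[F]_p.+1) :
  M *m (U^T *m U) = a%:M + const_mx b ->
  ('X - c%:P) ^+ p.+1 * char_poly (c%:M + U *m M *m U^T) =
  ('X - c%:P) ^+ m *
    (('X - (c + a)%:P) ^+ p * ('X - (c + (a + b *+ p.+1))%:P)).
Proof.
move=> MW; rewrite /char_poly /char_poly_mx.
have -> : 'X%:M - map_mx polyC (c%:M + U *m M *m U^T) =
          ('X - c%:P)%:M - map_mx polyC U *m map_mx polyC (M *m U^T).
  by rewrite map_mxD map_scalar_mx -map_mxM mulmxA raddfB opprD addrA.
rewrite mulrC det_scalar_sub_mulmx -map_mxM -mulmxA MW; congr (_ * _).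
rewrite map_mxD map_scalar_mx map_const_mx opprD addrA -raddfB.
rewrite -addrA -opprD -polyCD det_scalar_sub_const ?polyXsubC_eq0 //.
by rewrite !polyCD polyCMn !opprD !addrA.
Qed.

Lemma mxtrace_mul_delta (F : nzSemiRingType) (n : nat) (S : 'M[F]_n) i j :
  \tr (S *m delta_mx i j) = S j i.
Proof.
rewrite /mxtrace (bigD1 j) //= big1 => [|k kj]; last first.
  rewrite mxE big1 // => l _.
  by rewrite mxE (negPf kj) andbF mulr0.
rewrite addr0 mxE (bigD1 i) //= big1 => [|l li].
  by rewrite addr0 mxE !eqxx mulr1.
by rewrite mxE (negPf li) mulr0.
Qed.

(** * Gram matrices in an orthonormal basis *)

Section Orthonormal.
Variables (F : rcfType) (n m : nat) (E : m.-tuple 'M[F]_n).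
Hypothesis onbE : orthonormal_basis E.

Lemma orthonormal_basis_tr k : (tnth E k)^T = tnth E k.
Proof.
apply/eqP; rewrite -mem_symv; case: onbE => basE _.
exact: (basis_mem basE (mem_tnth k E)).
Qed.

Lemma orthonormal_basis_expand (S : 'M[F]_n) :
  S^T = S -> S = \sum_k \tr (tnth E k *m S) *: tnth E k.
Proof.
case: onbE => basE ortE /eqP; rewrite -mem_symv -(span_basis basE) => ES.
have defS := coord_span ES; rewrite {1}defS; apply: eq_bigr => k _.
rewrite (tnth_nth 0) [X in \tr (_ *m X)]defS; congr (_ *: _).
rewrite mulmx_sumr raddf_sum (bigD1 k) //= -scalemxAr mxtraceZ.
rewrite -!(tnth_nth 0 E k) ortE eqxx mulr1 big1 ?addr0 // => j jk.
by rewrite -scalemxAr mxtraceZ -!tnth_nth ortE eq_sym (negPf jk) mulr0.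
Qed.

Lemma parseval (S T : 'M[F]_n) : T^T = T ->
  \sum_k \tr (tnth E k *m S) * \tr (tnth E k *m T) = \tr (S *m T).
Proof.
move/orthonormal_basis_expand=> {2}->.
rewrite mulmx_sumr raddf_sum; apply: eq_bigr => k _ /=.
by rewrite -scalemxAr mxtraceZ mxtrace_mulC mulrC.
Qed.

(* The reproducing kernel of the symmetric matrices has trace [m], and by
   Parseval its diagonal entries are [(1 + (i == j)) / 2]. *)
Lemma orthonormal_basis_card : (m * 2 = n * n.+1)%N.
Proof.
pose D i j : 'M[F]_n := delta_mx i j + delta_mx j i.
have symD i j : (D i j)^T = D i j by rewrite raddfD /= !trmx_delta addrC.
have trED k i j : \tr (tnth E k *m D i j) = 2 * tnth E k i j.
  rewrite mulmxDr mxtraceD !mxtrace_mul_delta -{1}(orthonormal_basis_tr k) mxE.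
  by rewrite mulr_natl.
have trDD i j : \tr (D i j *m D i j) = 2 * (1 + (i == j)%:R).
  rewrite mulmxDr mxtraceD !mxtrace_mul_delta !mxE !eqxx.
  by rewrite (eq_sym j); case: (i == j) => /=; ring.
(* The triple sum is evaluated in two ways. With [k] outermost, each basis element contributes 4
   tr(E_k^2) = 4; with [k] innermost, Parseval gives tr(D_ij^2). *)
have H : \sum_i \sum_j \sum_k (2 * tnth E k i j) ^+ 2 = m%:R * 2 * 2 :> F.
  under eq_bigr => i _ do rewrite exchange_big.
  rewrite exchange_big /= -mulrA mulr_natl -[m in RHS]card_ord -sumr_const.
  apply: eq_bigr => k _; have trEE := onbE.2 k k.
  under eq_bigr => i _ do under eq_bigr => j _ do rewrite exprMn.
  under eq_bigr => i _ do rewrite -mulr_sumr.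
  rewrite eqxx in trEE; rewrite -mulr_sumr -[RHS]mulr1.
  rewrite -[X in _ = _ * X]trEE expr2; congr (_ * _); rewrite /mxtrace.
  apply: eq_bigr => i _; rewrite mxE; apply: eq_bigr => j _.
  by rewrite expr2 -{2}(orthonormal_basis_tr k) mxE.
apply/eqP; rewrite -(eqr_nat F) natrM; apply/eqP.
apply: (@mulIf _ 2); first by rewrite pnatr_eq0.
rewrite -H.
transitivity (\sum_(i < n) \sum_(j < n) (2 * (1 + (i == j)%:R) : F)).
  apply: eq_bigr => i _; apply: eq_bigr => j _.
  rewrite -trDD -parseval //; apply: eq_bigr => k _.
  by rewrite trED.
rewrite (eq_bigr (fun _ => (n.+1 * 2)%:R)) => [|i _].
  by rewrite sumr_const card_ord; ring.
rewrite -mulr_sumr big_split /= sumr_const card_ord (bigD1 i) //= eqxx.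
rewrite big1 => [|j ji]; last by rewrite eq_sym (negPf ji).
by rewrite addr0 -natrD -natrM addn1 mulnC.
Qed.

(** The columns of [U] are the coordinates of the [S i] in the basis, so Parseval identifies U^T U
    with the matrix of traces tr(S_i S_j), while orthonormality turns c tr(GH) into the scalar
    matrix c. *)
Lemma char_poly_gram (R : seq 'cV[F]_n) (p : nat) (a b c : F)
    (M : 'M[F]_p.+1) (S : 'I_p.+1 -> 'M[F]_n) :
  (forall i, (S i)^T = S i) ->
  (forall G H : 'M[F]_n, G^T = G -> H^T = H ->
    bQ R G H = c * \tr (G *m H) +
      \sum_i \sum_j M i j * \tr (G *m S i) * \tr (H *m S j)) ->
  M *m (\matrix_(i, j) \tr (S i *m S j)) = a%:M + const_mx b ->
  ('X - c%:P) ^+ p.+1 * char_poly (gram R E) =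
  ('X - c%:P) ^+ m *
    (('X - (c + a)%:P) ^+ p * ('X - (c + (a + b *+ p.+1))%:P)).
Proof.
move=> symS bQE MW.
pose U : 'M[F]_(m, p.+1) := \matrix_(k, i) \tr (tnth E k *m S i).
have -> : gram R E = c%:M + U *m M *m U^T.
  apply/matrixP=> k l; rewrite mxE bQE ?orthonormal_basis_tr // onbE.2.
  rewrite [RHS]mxE [X in _ = X + _]mxE mulr_natr; congr (_ + _).
  rewrite exchange_big /= [RHS]mxE; apply: eq_bigr => j _.
  rewrite [X in _ = X * _]mxE [X in _ = _ * X]mxE [X in _ = _ * X]mxE mulr_suml.
  by apply: eq_bigr => i _; rewrite mxE; ring.
apply: char_poly_scalar_add; rewrite -MW; congr (_ *m _).
apply/matrixP=> i j; rewrite !mxE -parseval //.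
by apply: eq_bigr => k _; rewrite !mxE.
Qed.

End Orthonormal.

(** * Transport to the ambient space *)

Lemma mxtrace_mul_tr_eq0 (F : realFieldType) (n : nat) (D : 'M[F]_n) :
  \tr (D^T *m D) = 0 -> D = 0.
Proof.
rewrite /mxtrace => trD; apply/matrixP=> i j; rewrite mxE.
have sq_ge0 k : 0 <= (D^T *m D) k k.
  by rewrite mxE sumr_ge0 // => l _; rewrite mxE -expr2 sqr_ge0.
have /eqP := psumr_eq0P (fun k _ => sq_ge0 k) trD (i := j) isT.
rewrite mxE psumr_eq0 => [/allP/(_ i (mem_index_enum _))|k _]; last first.
  by rewrite mxE -expr2 sqr_ge0.
by rewrite mxE /= mulf_eq0 orbb => /eqP.
Qed.

Lemma mxtrace_cV_tr (F : comNzRingType) (n : nat) (x : 'cV[F]_n) :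
  \tr (x *m x^T) = \sum_i x i 0 ^+ 2.
Proof. by apply: eq_bigr => i _; rewrite mxE big_ord1 mxE expr2. Qed.

Lemma qevalE (F : rcfType) (n : nat) (H : 'M[F]_n) (x : 'cV[F]_n) :
  qeval H x = \sum_i \sum_j H i j * x i 0 * x j 0.
Proof.
rewrite /qeval mxE exchange_big; apply: eq_bigr => j _.
by rewrite mxE mulr_suml; apply: eq_bigr => i _; rewrite mxE; ring.
Qed.

(** [B] is injective, having [B^T] as a left inverse, so the image of [R] is duplicate-free with the
    same members as [L]. Sums over [R] may then be taken over [L]. *)
Lemma is_systemP (F : rcfType) (N n : nat) (P : 'cV[F]_N -> Prop)
    (R : seq 'cV[F]_n) (L : seq 'cV[F]_N) :
  is_system P R -> uniq L -> (forall y, P y <-> y \in L) ->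
  exists2 B : 'M[F]_(N, n), B^T *m B = 1%:M & perm_eq (map (mulmx B) R) L.
Proof.
move=> [uR [B BB PB]] uL PL; exists B => //.
apply: uniq_perm => // [|y].
  rewrite map_inj_uniq // => x x' /(congr1 (mulmx B^T)).
  by rewrite !mulmxA BB !mul1mx.
apply/mapP/idP => [/PB/PL //|/PL/PB []] x Rx ->.
by exists x.
Qed.

Section Isometry.
Variables (F : rcfType) (N n : nat) (B : 'M[F]_(N, n)).
Variables (R : seq 'cV[F]_n) (L : seq 'cV[F]_N).
Hypotheses (BB : B^T *m B = 1%:M) (RL : perm_eq (map (mulmx B) R) L).

Lemma bQ_isometry (G H : 'M[F]_n) :
  bQ R G H =
  \sum_(y <- L) qeval (B *m G *m B^T) y * qeval (B *m H *m B^T) y.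
Proof.
rewrite -(perm_big _ RL) big_map; apply: eq_bigr => x _ /=.
have qB K : qeval (B *m K *m B^T) (B *m x) = qeval K x.
  rewrite /qeval trmx_mul !mulmxA -(mulmxA x^T B^T) BB mulmx1.
  by rewrite -(mulmxA _ B^T B) BB mulmx1.
by rewrite !qB.
Qed.

Lemma mxtrace_isometry (G : 'M[F]_n) : \tr (B *m G *m B^T) = \tr G.
Proof. by rewrite mxtrace_mulC mulmxA BB mul1mx. Qed.

Lemma mxtrace_isometry_mul (G H : 'M[F]_n) :
  \tr ((B *m G *m B^T) *m (B *m H *m B^T)) = \tr (G *m H).
Proof.
rewrite !mulmxA -(mulmxA _ B^T) BB mulmx1 -(mulmxA B).
exact: mxtrace_isometry.
Qed.

Lemma isometry_tr (G : 'M[F]_n) :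
  G^T = G -> (B *m G *m B^T)^T = B *m G *m B^T.
Proof. by move=> symG; rewrite !trmx_mul trmxK symG mulmxA. Qed.

Variables (k : F) (Q : 'M[F]_N).
Hypotheses (k0 : k != 0) (moment2 : \sum_(y <- L) y *m y^T = k *: Q).
Hypothesis trQ : \tr Q = n%:R.

(* [B *m B^T] fixes every vector of [L], hence fixes the columns of [Q]; both
   are orthogonal projections of the same trace. *)
Lemma isometry_mul_tr : Q *m Q = Q -> B *m B^T = Q.
Proof.
move=> QQ; set P := B *m B^T.
have symP : P^T = P by rewrite trmx_mul trmxK.
have PP : P *m P = P by rewrite /P mulmxA -(mulmxA B B^T) BB mulmx1.
have symQ : Q^T = Q.
  apply: (scalerI k0); rewrite -moment2 -linearZ /= -moment2 linear_sum.
  by apply: eq_bigr => y _; rewrite /= trmx_mul trmxK.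
have PQ : P *m Q = Q.
  apply: (scalerI k0); rewrite scalemxAr -moment2 mulmx_sumr.
  apply: eq_big_seq => y; rewrite -(perm_mem RL) => /mapP[x _ ->].
  by rewrite !mulmxA -(mulmxA B B^T) BB mulmx1.
have QP : Q *m P = Q by rewrite -{1}symQ -symP -trmx_mul PQ.
(* The symmetric matrix [P - Q] is its own square, so tr((P - Q)^T (P - Q)) = tr P - tr Q = n - n =
   0. *)
apply/eqP; rewrite -subr_eq0; apply/eqP/mxtrace_mul_tr_eq0.
rewrite [(P - Q)^T]raddfB /= symP symQ mulmxBr !mulmxBl PP PQ QP QQ subrr subr0.
by rewrite raddfB /= trQ mxtrace_mulC BB mxtrace1 subrr.
Qed.

(** In the trace of the second moment every root contributes its squared norm 2, whence 2 |R| = k n,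
    that is k = 2h. *)
Lemma coxeter_number_isometry :
  (0 < n)%N -> (forall y, y \in L -> \sum_i y i 0 ^+ 2 = 2) ->
  4%:R * coxeter_number R = 2 * k.
Proof.
move=> n0 normL.
have sizeR : 2 * (size R)%:R = k * n%:R :> F.
  rewrite -trQ -mxtraceZ -moment2 raddf_sum -(size_map (mulmx B)) /=.
  rewrite (perm_size RL) mulr_natr -iter_addr_0 -[size L]count_predT.
  rewrite -big_const_seq; apply: eq_big_seq => y Ly.
  by rewrite /= mxtrace_cV_tr normL.
have n0' : n%:R != 0 :> F by rewrite pnatr_eq0 -lt0n.
rewrite /coxeter_number mulrA; apply: (canLR (mulfK n0')).
by rewrite -mulrA -sizeR; ring.
Qed.

End Isometry.

(** * Sums over coordinate pairs *)

Section PairSums.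
Variables (F : comNzRingType) (N : nat).
Implicit Types G H : 'M[F]_N.

Lemma sum_ltn_pairs (V : zmodType) (f : 'I_N -> 'I_N -> V) :
  (forall i j, f i j = f j i) ->
  (\sum_(i < N) \sum_(j < N | (i < j)%N) f i j) *+ 2 =
  \sum_i \sum_j f i j - \sum_i f i i.
Proof.
move=> symf; apply/(canRL (addrK _)).
have swap : \sum_(i < N) \sum_(j < N | (j < i)%N) f i j =
            \sum_(i < N) \sum_(j < N | (i < j)%N) f i j.
  rewrite (exchange_big_dep xpredT) //=.
  by apply: eq_bigr => j _; apply: eq_bigr => i _; apply: symf.
rewrite mulr2n -{2}swap -!big_split; apply: eq_bigr => i _ /=.
rewrite [RHS](bigD1 i) //= addrC; congr (_ + _).
rewrite [RHS](bigID (fun j : 'I_N => (i < j)%N)) /=.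
by congr (_ + _); apply: eq_bigl => j; rewrite -val_eqE /= neq_ltn;
  case: ltngtP.
Qed.

(** For s^2 = 1 the factors are the values of G and H at e_i + s e_j. Keeping [s] general serves
    both types: the last line, odd in [s], vanishes in type A because rows sum to 0, and cancels
    between s = 1 and s = -1 in type D. *)
Lemma sum_pairs_mul G H (s : F) : G^T = G -> H^T = H ->
  \sum_i \sum_j (G i i + G j j + 2 * s * G i j) * (H i i + H j j + 2 * s * H i j)
  = 2 * N%:R * (\sum_i G i i * H i i) + 2 * (\sum_i \sum_j G i i * H j j) +
    4 * s ^+ 2 * \tr (G *m H) +
    4 * s * (\sum_i G i i * (\sum_j H i j) + \sum_i H i i * (\sum_j G i j)).
Proof.
move=> symG symH.
have trGH : \tr (G *m H) = \sum_i \sum_j G i j * H i j.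
  apply: eq_bigr => i _; rewrite mxE; apply: eq_bigr => j _.
  by rewrite -{2}symH mxE.
have const_j (f : 'I_N -> F) : \sum_i \sum_(j < N) f i = N%:R * \sum_i f i.
  rewrite mulr_sumr; apply: eq_bigr => i _.
  by rewrite sumr_const card_ord mulr_natl.
pose S1 := \sum_i \sum_(j < N) G i i * H i i.
pose S1' := \sum_(i < N) \sum_j G j j * H j j.
pose S2 := \sum_i \sum_j G i i * H j j.
pose S2' := \sum_i \sum_j G j j * H i i.
pose S3 := \sum_i \sum_j G i j * H i j.
pose T1 := \sum_i \sum_j G i i * H i j.
pose T1' := \sum_i \sum_j G j j * H i j.
pose T2 := \sum_i \sum_j H i i * G i j.
pose T2' := \sum_i \sum_j H j j * G i j.
transitivity (S1 + S1' + (S2 + S2') + 4 * s ^+ 2 * S3 +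
   2 * s * ((T1 + T1') + (T2 + T2'))).
  rewrite !mulrDr !mulr_sumr -!big_split; apply: eq_bigr => i _ /=.
  rewrite !mulr_sumr -!big_split; apply: eq_bigr => j _ /=; ring.
have -> : S1' = S1 by rewrite /S1' exchange_big.
have -> : S2' = S2 by rewrite /S2' exchange_big.
have swapT K : K^T = K -> forall L : 'M[F]_N,
    \sum_i \sum_j L j j * K i j = \sum_i \sum_j L i i * K i j.
  move=> symK L; rewrite exchange_big; apply: eq_bigr => i _.
  by apply: eq_bigr => j _; rewrite -{1}symK mxE.
have -> : T1' = T1 by apply: swapT.
have -> : T2' = T2 by apply: swapT.
have -> : \sum_i G i i * (\sum_j H i j) = T1.
  by apply: eq_bigr => i _; rewrite mulr_sumr.
have -> : \sum_i H i i * (\sum_j G i j) = T2.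
  by apply: eq_bigr => i _; rewrite mulr_sumr.
by rewrite trGH -/S2 -/S3 /S1 const_j; ring.
Qed.

Lemma mulmx_scalar_const (a b a' b' : F) :
  (a%:M + const_mx b) *m (a'%:M + const_mx b') =
  (a * a')%:M + const_mx (a * b' + a' * b + b * b' * N%:R) :> 'M[F]_N.
Proof.
rewrite mulmxDl !mulmxDr scalar_mxM !mul_scalar_mx mul_mx_scalar -!addrA.
congr (_ + _); apply/matrixP=> i j; rewrite !mxE !addrA; congr (_ + _).
by under eq_bigr do rewrite !mxE; rewrite sumr_const card_ord mulr_natr.
Qed.

Lemma sum_scalar_const (a b : F) (u v : 'I_N -> F) :
  \sum_i \sum_j (a%:M + const_mx b : 'M_N) i j * u i * v j =
  a * (\sum_i u i * v i) + b * (\sum_i \sum_j u i * v j).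
Proof.
rewrite !mulr_sumr -big_split; apply: eq_bigr => i _ /=.
rewrite (eq_bigr (fun j => (i == j)%:R * (a * (u i * v i)) + b * (u i * v j))).
  rewrite big_split /= -mulr_suml -mulr_sumr (bigD1 i) //= eqxx big1 => [|j ji].
    by rewrite addr0 mul1r.
  by rewrite eq_sym (negPf ji).
by move=> j _; rewrite !mxE; have [->|_] := eqVneq i j => /=; ring.
Qed.

End PairSums.

(** * Diagonal units pulled back to the span of the roots *)

Section DiagonalFamily.
Variables (F : rcfType) (N n : nat) (B : 'M[F]_(N, n)).

(** This is v v^T for v = B^T e_i; pairing with it reads off a diagonal entry of B G B^T. *)
Definition diag_pullback (i : 'I_N) : 'M[F]_n := B^T *m delta_mx i i *m B.

Lemma diag_pullback_tr i : (diag_pullback i)^T = diag_pullback i.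
Proof. by rewrite /diag_pullback !trmx_mul trmxK trmx_delta mulmxA. Qed.

Lemma mxtrace_diag_pullback (G : 'M[F]_n) i :
  \tr (G *m diag_pullback i) = (B *m G *m B^T) i i.
Proof.
rewrite /diag_pullback !mulmxA mxtrace_mulC !mulmxA.
exact: mxtrace_mul_delta.
Qed.

Lemma mxtrace_diag_pullback2 i j :
  \tr (diag_pullback i *m diag_pullback j) = (B *m B^T) i j ^+ 2.
Proof.
have symP : (B *m B^T)^T = B *m B^T by rewrite trmx_mul trmxK.
rewrite mxtrace_diag_pullback /diag_pullback !mulmxA -(mulmxA _ B).
rewrite -(mul_delta_mx (0 : 'I_1)) (mulmxA _ (delta_mx i 0)) -colE.
rewrite -(mulmxA _ (delta_mx 0 i)) -rowE mxE big_ord1.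
by rewrite -{1}symP -tr_row [_^T j _]mxE ![row _ _ _ _]mxE expr2.
Qed.

End DiagonalFamily.

(** * Values and moments at the vectors e_i + s e_j *)

Section PlaneVectors.
Variables (F : rcfType) (N : nat).
Implicit Types (i j : 'I_N) (s : F).

Lemma qeval_bvec2 (H : 'M[F]_N) i j s : H^T = H ->
  qeval H (bvec F i + s *: bvec F j) = H i i + s ^+ 2 * H j j + 2 * s * H i j.
Proof.
move=> symH; rewrite /qeval -mulmxA mulmxDr -scalemxAr -!colE.
rewrite [(_ + _)^T]raddfD /= [(s *: _)^T]linearZ /= !trmx_delta mulmxDl 
  -scalemxAl -!rowE.
by rewrite !mxE (_ : H j i = H i j); [ring | rewrite -{1}symH mxE].
Qed.

Lemma bvec2_mul_tr i j s :
  (bvec F i + s *: bvec F j) *m (bvec F i + s *: bvec F j)^T =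
  delta_mx i i + s ^+ 2 *: delta_mx j j + s *: (delta_mx i j + delta_mx j i).
Proof.
rewrite [(_ + _)^T]raddfD /= [(s *: _)^T]linearZ /= !trmx_delta.
rewrite mulmxDr !mulmxDl -!scalemxAr -!scalemxAl !mul_delta_mx scalerA -expr2.
by apply/matrixP=> k l; rewrite !mxE; ring.
Qed.

Lemma bvec2_norm i j s : i != j ->
  \sum_k (bvec F i + s *: bvec F j) k 0 ^+ 2 = 1 + s ^+ 2.
Proof.
move=> ij; rewrite -mxtrace_cV_tr bvec2_mul_tr !mxtraceD !mxtraceZ mxtraceD.
have tr_delta k l : \tr (delta_mx k l : 'M[F]_N) = (k == l)%:R.
  by rewrite -[delta_mx k l]mul1mx mxtrace_mul_delta mxE eq_sym.
rewrite !tr_delta !eqxx (eq_sym j) (negPf ij) !addr0 !mulr0.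
by rewrite addr0 mulr1.
Qed.

End PlaneVectors.

(** * The systems of type A and D *)

Section TypeA.
Variables (F : rcfType) (N : nat).

(** Ordered pairs absorb the global sign, and the factor [-1 *:] gives the shape e_i + s e_j shared
    with type D. *)
Definition rootsA : seq 'cV[F]_N :=
  [seq bvec F p.1 + -1 *: bvec F p.2 |
     p <- enum [pred p : 'I_N * 'I_N | p.1 != p.2]].

Lemma rootsA_uniq : uniq rootsA.
Proof.
rewrite map_inj_in_uniq ?enum_uniq // => -[i j] [k l] /=.
rewrite !mem_enum !inE /= => ij kl /matrixP eq_y.
have := eq_y i 0; have := eq_y j 0; rewrite !mxE !eqxx !andbT.
rewrite (eq_sym j i) (negPf ij) => yj yi.
have /eqP-> : i == k.
  by move: yi; case: (i == k) => //; case: (i == l) => /= ?; exfalso; lra.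
have /eqP-> // : j == l.
by move: yj; case: (j == l) => //; case: (j == k) => /= ?; exfalso; lra.
Qed.

(** The diagonal pairs give the zero vector, so under [f 0 = 0] they may be included in the sum. *)
Lemma rootsA_sum (V : nmodType) (f : 'cV[F]_N -> V) : f 0 = 0 ->
  \sum_(y <- rootsA) f y = \sum_i \sum_j f (bvec F i + -1 *: bvec F j).
Proof.
move=> f0; rewrite big_map big_enum /= pair_big /=.
rewrite [RHS](bigID (fun p => p.1 != p.2)) /=.
rewrite [X in _ = _ + X]big1 ?addr0 // => -[i j] /negPn/eqP /= ->.
by rewrite scaleN1r subrr.
Qed.

End TypeA.

Section TypeD.
Variables (F : rcfType) (n : nat).

Definition vecD (p : ('I_n * 'I_n) * (bool * bool)) : 'cV[F]_n :=
  (-1) ^+ p.2.1 *: (bvec F p.1.1 + (-1) ^+ p.2.2 *: bvec F p.1.2).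

Definition rootsD : seq 'cV[F]_n :=
  [seq vecD p | p <- enum [pred p : ('I_n * 'I_n) * (bool * bool) |
                             (p.1.1 < p.1.2)%N]].

(** For even [f] the global sign only doubles the sum, leaving the relative sign as the two
    summands. *)
Lemma rootsD_sum (V : nmodType) (f : 'cV[F]_n -> V) :
  (forall y, f (- y) = f y) ->
  \sum_(y <- rootsD) f y =
  (\sum_(i < n) \sum_(j < n | (i < j)%N)
     (f (bvec F i + 1 *: bvec F j) + f (bvec F i + -1 *: bvec F j))) *+ 2.
Proof.
move=> fN; rewrite big_map big_enum /=.
transitivity (\sum_(p : 'I_n * 'I_n | (p.1 < p.2)%N)
                \sum_(q : bool * bool) f (vecD (p, q))).
  by rewrite pair_big /=; apply: eq_big => [p|[p q] _]; rewrite ?andbT.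
rewrite [X in _ = X *+ 2]pair_big_dep /= -sumrMnl.
apply: eq_bigr => -[i j] _ /=.
rewrite -(pair_bigA _ (fun a b => f (vecD ((i, j), (a, b))))) /=.
rewrite !big_bool /vecD /= !expr0 !expr1 !scaleN1r !fN !scale1r -mulr2n.
by rewrite [X in X *+ 2]addrC.
Qed.

Lemma vecD_neq0 (i j : 'I_n) (q : bool * bool) x : (i < j)%N ->
  (vecD ((i, j), q) x 0 != 0) = (x == i) || (x == j).
Proof.
move=> ij; rewrite !mxE mulf_eq0 signr_eq0 !andbT /=.
have [->|xi] := eqVneq x i.
  by rewrite -val_eqE (ltn_eqF ij) mulr0 addr0 oner_eq0.
by rewrite add0r mulf_eq0 signr_eq0 /= pnatr_eq0 eqb0 negbK.
Qed.

Lemma rootsD_uniq : uniq rootsD.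
Proof.
rewrite map_inj_in_uniq ?enum_uniq // => -[[i j] [a b]] [[k l] [c d]].
rewrite !mem_enum !inE /= => ij kl /matrixP eq_y.
have sgn_inj (x y : bool) : (-1) ^+ x = (-1) ^+ y :> F -> x = y.
  by case: x y => [] [] //=; rewrite expr0 expr1 => ?; exfalso; lra.
(* Equal vectors have equal supports {i, j} = {k, l}, and the ordering i < j, k < l then matches the
   indices. The entry at [i] determines the first sign, the entry at [j] the second. *)
have [ik jl] : i = k /\ j = l.
  have supp x : (x == i) || (x == j) = ((x == k) || (x == l)).
    by rewrite -(vecD_neq0 (a, b)) // -(vecD_neq0 (c, d)) // eq_y.
  have := supp i; have := supp j; have := supp k; have := supp l.
  rewrite !eqxx !orbT /= -!val_eqE /= => si sj sk sl.
  by split; apply: val_inj => /=; lia.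
subst k l; have := eq_y i 0; have := eq_y j 0.
rewrite !mxE !eqxx -!val_eqE /= (ltn_eqF ij) (gtn_eqF ij) /=.
rewrite !mulr0 !add0r !addr0 !mulr1 => yj yi.
have ac := sgn_inj _ _ yi; subst c.
by move: yj; rewrite -!signr_addb => /(@sgn_inj _ _)/addbI->.
Qed.

Lemma rootsDP y : rootD y <-> y \in rootsD.
Proof.
split=> [[i [j [a [b [ij ->]]]]]|/mapP[[[i j] [a b]]]].
  by apply/mapP; exists ((i, j), (a, b)); rewrite ?mem_enum.
by rewrite mem_enum => ij ->; exists i, j, a, b.
Qed.

End TypeD.

Lemma rootsAP (F : rcfType) (n : nat) (y : 'cV[F]_n.+1) :
  rootA y <-> y \in rootsA F n.+1.
Proof.
split=> [[i [j [a [ij ->]]]]|/mapP[[i j]]].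
  apply/mapP; exists (if a then (j, i) else (i, j)).
    by rewrite mem_enum inE; case: a => /=;
      rewrite -val_eqE /= neq_ltn ij ?orbT.
  by case: a => /=; rewrite ?expr0 ?expr1 ?scale1r ?scaleN1r ?opprB.
rewrite mem_enum inE /= -val_eqE /= neq_ltn => /orP[ij|ji] ->.
  by exists i, j, false; rewrite expr0 scale1r scaleN1r.
by exists j, i, true; rewrite expr1 !scaleN1r opprB.
Qed.

(** * Second moments of the systems of type A and D *)

Section Projections.
Variables (F : rcfType) (N : nat).

Lemma sum_delta_mx : \sum_i \sum_j delta_mx i j = const_mx 1 :> 'M[F]_N.
Proof.
rewrite [RHS]matrix_sum_delta; apply: eq_bigr => i _.
by apply: eq_bigr => j _; rewrite mxE scale1r.
Qed.

Lemma sum_delta_mx_diag : \sum_i delta_mx i i = 1%:M :> 'M[F]_N.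
Proof. by rewrite mx1_sum_delta. Qed.

Lemma sum_bvec2_mul_tr (s : F) : s ^+ 2 = 1 ->
  \sum_i \sum_j (bvec F i + s *: bvec F j) *m (bvec F i + s *: bvec F j)^T =
  (2 * N%:R)%:M + const_mx (2 * s) :> 'M[F]_N.
Proof.
move=> s2; under eq_bigr => i _ do under eq_bigr => j _ do
  rewrite bvec2_mul_tr s2 scale1r.
have sum1 : \sum_i \sum_(j < N) delta_mx i i = N%:R *: 1%:M :> 'M[F]_N.
  rewrite -sum_delta_mx_diag scaler_sumr; apply: eq_bigr => i _.
  by rewrite sumr_const card_ord scaler_nat.
transitivity (\sum_i \sum_(j < N) delta_mx i i +
  \sum_(i < N) \sum_j delta_mx j j +
  s *: (\sum_i \sum_j delta_mx i j + \sum_i \sum_j delta_mx j i) : 'M[F]_N).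
  rewrite -!big_split scaler_sumr -big_split; apply: eq_bigr => i _ /=.
  by rewrite -!big_split scaler_sumr -big_split; apply: eq_bigr.
rewrite [X in _ + X + _]exchange_big [X in _ *: (_ + X)]exchange_big /=.
rewrite sum1 sum_delta_mx; apply/matrixP=> i j; rewrite !mxE.
by case: (i == j) => /=; ring.
Qed.

(** The matrix 1 - J/N is the orthogonal projection onto the complement of the all-ones vector, and
    the factor 2N is 2h. *)
Lemma moment2_rootsA : (0 < N)%N ->
  \sum_(y <- rootsA F N) y *m y^T = (2 * N%:R) *: (1%:M + const_mx (- N%:R^-1)).
Proof.
move=> N0; have N0' : N%:R != 0 :> F by rewrite pnatr_eq0 -lt0n.
rewrite rootsA_sum ?mul0mx // sum_bvec2_mul_tr ?sqrrN ?expr1n //.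
apply/matrixP=> i j; rewrite !mxE.
by case: (i == j) => /=; field; rewrite ?N0'.
Qed.

Lemma moment2_rootsD :
  \sum_(y <- rootsD F N) y *m y^T = (4 * (N%:R - 1)) *: 1%:M.
Proof.
have ytN (y : 'cV[F]_N) : - y *m (- y)^T = y *m y^T.
  by rewrite raddfN /= mulmxN mulNmx opprK.
rewrite (rootsD_sum ytN) sum_ltn_pairs => [|i j]; last first.
  rewrite !bvec2_mul_tr; apply/matrixP=> k l; rewrite !mxE; ring.
under eq_bigr do rewrite big_split /=.
rewrite big_split /= !sum_bvec2_mul_tr ?sqrrN ?expr1n //.
(* On the diagonal e_i - e_i vanishes and e_i + e_i = 2 e_i contributes the factor 4. *)
rewrite (eq_bigr (fun i => 4 *: delta_mx i i)) => [|i _]; last first.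
  by rewrite !bvec2_mul_tr; apply/matrixP=> k l; rewrite !mxE; ring.
rewrite -scaler_sumr sum_delta_mx_diag.
by apply/matrixP=> i j; rewrite !mxE; case: (i == j) => /=; ring.
Qed.

End Projections.

(** With N = n + 1 the data are c = 4, M = 2N + 2J and M W = (2N - 4) + 2J. This yields 2N with
    multiplicity n, 4N once, and 4 on the remaining m - N dimensions. *)
Lemma Q_eigenvalues_rootA (F : rcfType) (n : nat) (R : seq 'cV[F]_n) :
  (1 <= n)%N -> is_system (@rootA F n) R ->
  4%:R * coxeter_number R = (4 * (n + 1))%:R /\
  Q_eigenvalues R
    ((4%:R * coxeter_number R, 1%N) ::
     if (2 <= n)%N
     then [:: ((2 * (n + 1))%:R, n); (4%:R, ((n * (n - 1)) %/ 2 - 1)%N)]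
     else [::]).
Proof.
move=> n1 sysR.
have [B BB RL] := is_systemP sysR (rootsA_uniq F n.+1) (@rootsAP F n).
have [N NE] : exists N : F, N = n.+1%:R by eexists.
have N0 : N != 0 by rewrite NE pnatr_eq0.
have k0 : 2 * N != 0 by rewrite mulf_neq0 ?pnatr_eq0.
have mom2 := moment2_rootsA F (ltn0Sn n); rewrite -NE in mom2.
pose Q : 'M[F]_n.+1 := 1%:M + const_mx (- N^-1).
have trQ : \tr Q = n%:R.
  rewrite mxtraceD mxtrace1 /mxtrace.
  rewrite [X in _ + X](eq_bigr (fun=> - N^-1)) => [|i _]; last by rewrite mxE.
  by rewrite sumr_const card_ord -[X in _ + X]mulr_natr -NE mulNr mulVf //
    NE -natr1 addrK.
have QQ : Q *m Q = Q.
  rewrite /Q mulmx_scalar_const -NE.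
  by congr (_%:M + const_mx _); field; rewrite ?N0.
have BBt : B *m B^T = Q := isometry_mul_tr BB RL k0 mom2 trQ QQ.
have cox : 4%:R * coxeter_number R = (4 * (n + 1))%:R.
  rewrite (coxeter_number_isometry RL mom2 trQ n1) => [|y].
    by rewrite natrM natrD NE -natr1; ring.
  move=> /mapP[[i j]]; rewrite mem_enum inE /= => ij ->.
  by rewrite bvec2_norm // sqrrN expr1n.
split=> // m E onbE; rewrite cox.
(* The all-ones vector is killed by Q = B B^T, hence by B^T = B^T Q; so all rows of B G B^T sum to 0
   and the mixed terms of the pair sum disappear. *)
have B1 : B^T *m const_mx 1 = 0 :> 'cV_n.
  rewrite -[B^T]mul1mx -BB -(mulmxA _ B) BBt -mulmxA.
  have -> : Q *m const_mx 1 = 0 :> 'cV_n.+1; last by rewrite mulmx0.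
  apply/matrixP=> i j; rewrite mulmxDl mul1mx !mxE.
  under eq_bigr do rewrite !mxE mulr1.
  by rewrite sumr_const card_ord -[X in _ + X]mulr_natr -NE mulNr mulVf //
    subrr.
have row0 (G : 'M[F]_n) i : \sum_j (B *m G *m B^T) i j = 0.
  have /matrixP/(_ i 0) : B *m G *m B^T *m const_mx 1 = 0 :> 'cV_n.+1.
    by rewrite -mulmxA B1 mulmx0.
  rewrite !mxE => {2}<-; apply: eq_bigr => j _.
  by rewrite [const_mx _ _ _]mxE mulr1.
have bQE (G H : 'M[F]_n) : G^T = G -> H^T = H ->
  bQ R G H = 4 * \tr (G *m H) + \sum_i \sum_j
    ((2 * N)%:M + const_mx 2 : 'M_n.+1) i j *
    \tr (G *m diag_pullback B i) * \tr (H *m diag_pullback B j).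
  move=> symG symH; rewrite (bQ_isometry BB RL).
  set G' := B *m G *m B^T; set H' := B *m H *m B^T.
  have symG' : G'^T = G' := isometry_tr B symG.
  have symH' : H'^T = H' := isometry_tr B symH.
  have trGH : \tr (G' *m H') = \tr (G *m H) := mxtrace_isometry_mul BB G H.
  rewrite rootsA_sum; last by rewrite /qeval !mulmx0 mxE mul0r.
  transitivity (\sum_i \sum_j (G' i i + G' j j + 2 * -1 * G' i j) *
                               (H' i i + H' j j + 2 * -1 * H' i j)).
    apply: eq_bigr => i _; apply: eq_bigr => j _.
    by rewrite !qeval_bvec2 // sqrrN expr1n !mul1r.
  rewrite sum_pairs_mul // trGH -NE.
  rewrite [X in 4 * -1 * (X + _)]big1 => [|i _]; last by rewrite row0 mulr0.
  rewrite [X in 4 * -1 * (_ + X)]big1 => [|i _]; last by rewrite row0 mulr0.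
  rewrite sqrrN expr1n addr0 mulr0 addr0 mulr1 addrC; congr (_ + _).
  under [RHS]eq_bigr => i _ do under eq_bigr => j _ do
    rewrite !mxtrace_diag_pullback.
  by rewrite sum_scalar_const.
have MW : ((2 * N)%:M + const_mx 2 : 'M_n.+1) *m
    (\matrix_(i, j) \tr (diag_pullback B i *m diag_pullback B j)) =
    (2 * N - 4)%:M + const_mx 2.
  (* The entries of W are the squares of those of 1 - J/N: (1 - 1/N)^2 on the diagonal and 1/N^2 off
     it. *)
  rewrite (_ : (\matrix_(_, _) _) = (1 - 2 / N)%:M + const_mx (N ^- 2)).
    rewrite mulmx_scalar_const -NE.
    by congr (_%:M + const_mx _); field; rewrite ?N0.
  apply/matrixP=> i j; rewrite !mxE mxtrace_diag_pullback2 BBt !mxE.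
  by case: (i == j) => /=; field; rewrite ?N0.
have := char_poly_gram onbE (diag_pullback_tr B) bQE MW.
have -> : 4 + (2 * N - 4) = (2 * (n + 1))%:R.
  by rewrite natrM natrD NE -natr1; ring.
have -> : 4 + (2 * N - 4 + 2 *+ n.+1) = (4 * (n + 1))%:R.
  by rewrite natrM natrD -[2 *+ _]mulr_natr NE -natr1; ring.
have X0 : 'X - 4%:P != 0 :> {poly F} by rewrite polyXsubC_eq0.
have cardE := orthonormal_basis_card onbE.
move=> chiE; apply: (mulfI (expf_neq0 n.+1 X0)); rewrite chiE.
rewrite !big_cons /= expr1; case: ifP => n2.
  rewrite !big_cons big_nil /=.
  rewrite (_ : m = (n.+1 + ((n * (n - 1)) %/ 2 - 1))%N) ?exprD; first by ring.
  by have : (n * n.+1 = n * (n - 1) + n * 2)%N; nia.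
(* For n = 1 one has m = 1 < n + 1, but the value 2(n + 1) coincides with c = 4, so the surplus
   factor X - 4 cancels and only X - 8 remains. *)
rewrite big_nil; move: cardE.
have -> : n = 1%N by lia.
move=> cardE; have -> : m = 1%N by lia.
by ring.
Qed.

(** The roots span the whole space, so B B^T = 1 and W = 1. The data are c = 8 and M = (4n - 16) +
    4J, giving 4(n - 2) with multiplicity n - 1, 8(n - 1) once, and 8 on the remaining m - n
    dimensions. *)
Lemma Q_eigenvalues_rootD (F : rcfType) (n : nat) (R : seq 'cV[F]_n) :
  (4 <= n)%N -> is_system (@rootD F n) R ->
  4%:R * coxeter_number R = (8 * (n - 1))%:R /\
  Q_eigenvalues R
    [:: (4%:R * coxeter_number R, 1%N);
        ((4 * (n - 2))%:R, (n - 1)%N);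
        (8%:R, ((n * (n - 1)) %/ 2)%N)].
Proof.
case: n R => // n R n3 sysR.
have [B BB RL] := is_systemP sysR (rootsD_uniq F n.+1) (@rootsDP F n.+1).
have BBt : B *m B^T = 1%:M := mulmx1C BB.
have [N NE] : exists N : F, N = n.+1%:R by eexists.
have cox : 4%:R * coxeter_number R = (8 * (n.+1 - 1))%:R.
  have mom2 := moment2_rootsD F n.+1.
  rewrite (coxeter_number_isometry RL mom2 (mxtrace1 _ _)) // => [|y].
    by rewrite subn1 -natr1 natrM; ring.
  move=> /mapP[[[i j] [a b]]]; rewrite mem_enum inE /= => ij ->.
  rewrite /vecD; under eq_bigr do rewrite mxE exprMn sqrr_sign mul1r.
  by rewrite bvec2_norm ?sqrr_sign // -val_eqE /= ltn_eqF.
split=> // m E onbE; rewrite cox.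
have bQE (G H : 'M[F]_n.+1) : G^T = G -> H^T = H ->
  bQ R G H = 8 * \tr (G *m H) + \sum_i \sum_j
    ((4 * N - 16)%:M + const_mx 4 : 'M_n.+1) i j *
    \tr (G *m diag_pullback B i) * \tr (H *m diag_pullback B j).
  move=> symG symH; rewrite (bQ_isometry BB RL).
  under [in RHS]eq_bigr => i _ do under eq_bigr => j _ do
    rewrite !mxtrace_diag_pullback.
  rewrite sum_scalar_const.
  rewrite -(mxtrace_isometry_mul BB).
  move: (B *m G *m B^T) (B *m H *m B^T)
    (isometry_tr B symG) (isometry_tr B symH).
  move=> {symG symH}G {}H symG symH.
  have qN (K : 'M[F]_n.+1) y : qeval K (- y) = qeval K y.
    by rewrite /qeval [(- y)^T]raddfN /= mulmxN !mulNmx opprK.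
  rewrite rootsD_sum => [|y]; last by rewrite !qN.
  have qE (K : 'M[F]_n.+1) s i j : K^T = K -> s ^+ 2 = 1 ->
      qeval K (bvec F i + s *: bvec F j) = K i i + K j j + 2 * s * K i j.
    by move=> symK s2; rewrite qeval_bvec2 // s2 mul1r.
  have s1 : (1 : F) ^+ 2 = 1 by rewrite expr1n.
  have sN1 : (-1 : F) ^+ 2 = 1 by rewrite sqrrN expr1n.
  have swap (K : 'M[F]_n.+1) i j : K^T = K -> K j i = K i j.
    by move=> symK; rewrite -{1}symK mxE.
  rewrite sum_ltn_pairs => [|i j]; last first.
    by rewrite !qE // (swap G i j) // (swap H i j) //; ring.
  (* The diagonal terms removed here come from 2 e_i alone, with value (4 G_ii)(4 H_ii); this is the
     source of the -16 in M. *)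
  rewrite [X in _ - X](eq_bigr (fun i => 16 * (G i i * H i i))); last first.
    by move=> i _; rewrite !qE //; ring.
  rewrite -mulr_sumr.
  under eq_bigr => i _ do (under eq_bigr => j _ do rewrite !qE //).
  under eq_bigr => i _ do rewrite big_split /=.
  by rewrite big_split /= !sum_pairs_mul // -NE; ring.
have MW : ((4 * N - 16)%:M + const_mx 4 : 'M_n.+1) *m
    (\matrix_(i, j) \tr (diag_pullback B i *m diag_pullback B j)) =
    (4 * N - 16)%:M + const_mx 4.
  rewrite (_ : (\matrix_(_, _) _) = 1%:M) ?mulmx1 //.
  apply/matrixP=> i j; rewrite !mxE mxtrace_diag_pullback2 BBt !mxE.
  by case: (i == j) => /=; ring.
have := char_poly_gram onbE (diag_pullback_tr B) bQE MW.
have -> : 8 + (4 * N - 16) = (4 * (n.+1 - 2))%:R.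
  by rewrite natrM natrB ?NE; [ring | lia].
have -> : 8 + (4 * N - 16 + 4 *+ n.+1) = (8 * (n.+1 - 1))%:R.
  by rewrite natrM subn1 -[4 *+ _]mulr_natr NE -natr1 /=; ring.
have X0 : 'X - 8%:P != 0 :> {poly F} by rewrite polyXsubC_eq0.
have cardE := orthonormal_basis_card onbE.
move=> chiE; apply: (mulfI (expf_neq0 n.+1 X0)); rewrite chiE.
rewrite !big_cons big_nil /= expr1 subn1 /=.
rewrite (_ : m = (n.+1 + ((n.+1 * n) %/ 2))%N) ?exprD; first by ring.
by have : (n.+1 * n.+2 = n.+1 * n + n.+1 * 2)%N; nia.
Qed.

(** * Designs of strength 4 *)

Section Design.
Variables (F : rcfType) (N n : nat) (B : 'M[F]_(N, n)).
Variables (R : seq 'cV[F]_n) (L : seq 'cV[F]_N) (Q : 'M[F]_N) (c : F).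
Hypotheses (BB : B^T *m B = 1%:M) (RL : perm_eq (map (mulmx B) R) L).
Hypothesis BBt : B *m B^T = Q.
Hypothesis moment4 : forall i j a b,
  \sum_(y <- L) y i 0 * y j 0 * (y a 0 * y b 0) =
  c * (Q i j * Q a b + Q i a * Q j b + Q i b * Q j a).

(** The fourth moment is contracted with G' = B G B^T in two indices and H' = B H B^T in the others.
    As Q acts as the identity on both, the three pairings yield tr G tr H and twice tr(GH). *)
Lemma bQ_design (G H : 'M[F]_n) : G^T = G -> H^T = H ->
  bQ R G H = c * (\tr G * \tr H + 2 * \tr (G *m H)).
Proof.
move=> symG symH; rewrite (bQ_isometry BB RL).
set G' := B *m G *m B^T; set H' := B *m H *m B^T.
have symG' : G'^T = G' := isometry_tr B symG.
have symQ : Q^T = Q by rewrite -BBt trmx_mul trmxK.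
have GQ : G' *m Q = G' by rewrite -BBt !mulmxA -(mulmxA _ B^T) BB mulmx1.
have QG : Q *m G' = G' by rewrite -{1}symQ -symG' -trmx_mul GQ.
have HQ : H' *m Q = H' by rewrite -BBt !mulmxA -(mulmxA _ B^T) BB mulmx1.
have trGH : \tr (G' *m H') = \tr (G *m H) := mxtrace_isometry_mul BB G H.
have trmulE (K M : 'M[F]_N) : M^T = M ->
    \tr (K *m M) = \sum_i \sum_j K i j * M i j.
  move=> symM; apply: eq_bigr => i _; rewrite mxE; apply: eq_bigr => j _.
  by rewrite -{1}symM mxE.
have QGQ a b : \sum_i \sum_j G' i j * (Q i a * Q j b) = G' a b.
  rewrite -[in RHS]QG -[in RHS]GQ mulmxA mxE exchange_big.
  apply: eq_bigr => j _ /=.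
  rewrite mxE mulr_suml; apply: eq_bigr => i _.
  by rewrite -{1}symQ [Q^T _ _]mxE; ring.
have trG : \tr G = \sum_i \sum_j G' i j * Q i j.
  by rewrite -(mxtrace_isometry BB) -/G' -[in LHS]GQ trmulE.
have trH : \tr H = \sum_i \sum_j H' i j * Q i j.
  by rewrite -(mxtrace_isometry BB) -/H' -[in LHS]HQ trmulE.
have contract a b : \sum_(y <- L) qeval G' y * (y a 0 * y b 0) =
    c * (\tr G * Q a b + 2 * G' a b).
  have -> : 2 * G' a b = G' a b + G' b a
    by rewrite -{3}symG' [G'^T _ _]mxE mulr_natl.
  rewrite trG -(QGQ a b) -(QGQ b a).
  under eq_bigr do rewrite qevalE mulr_suml.
  rewrite exchange_big mulr_suml -!big_split mulr_sumr; apply: eq_bigr => i _ /=.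
  under eq_bigr do rewrite mulr_suml.
  rewrite exchange_big mulr_suml -!big_split mulr_sumr; apply: eq_bigr => j _ /=.
  under eq_bigr do rewrite -!mulrA (mulrA (_ i 0)).
  by rewrite -mulr_sumr moment4; ring.
under eq_bigr do rewrite [qeval H' _]qevalE mulr_sumr.
rewrite exchange_big /= trH -trGH mxtrace_mulC trmulE //.
rewrite !mulr_sumr -big_split mulr_sumr; apply: eq_bigr => a _ /=.
under eq_bigr do rewrite mulr_sumr.
rewrite exchange_big !mulr_sumr -big_split mulr_sumr; apply: eq_bigr => b _ /=.
transitivity (\sum_(y <- L) H' a b * (qeval G' y * (y a 0 * y b 0))).
  by apply: eq_bigr => y _; ring.
by rewrite -mulr_sumr contract; ring.
Qed.

(** The family [S] is the identity matrix alone, with M = (c) and W = (n): its eigenvalue is 2c +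
    cn, and 2c remains on the trace-free matrices. *)
Lemma char_poly_gram_design (m : nat) (E : m.-tuple 'M[F]_n) :
  orthonormal_basis E -> (0 < m)%N ->
  char_poly (gram R E) =
  ('X - (c * (2 + n%:R))%:P) * ('X - (2 * c)%:P) ^+ m.-1.
Proof.
move=> onbE m0.
have bQE (G H : 'M[F]_n) : G^T = G -> H^T = H ->
    bQ R G H = 2 * c * \tr (G *m H) + \sum_(i < 1) \sum_(j < 1)
      (c%:M : 'M_1) i j * \tr (G *m 1%:M) * \tr (H *m 1%:M).
  move=> symG symH; rewrite bQ_design //.
  by rewrite !big_ord1 !mulmx1 mxE eqxx mulr1n; ring.
have X0 : 'X - (2 * c)%:P != 0 :> {poly F} by rewrite polyXsubC_eq0.
apply: (mulfI X0); rewrite -[X in X * _ = _]expr1.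
rewrite (char_poly_gram (a := 0) (b := c * n%:R) onbE _ bQE) => [|i|].
- have -> : 2 * c + (0 + (c * n%:R) *+ 1) = c * (2 + n%:R) by ring.
  by rewrite -{1}(prednK m0) exprS; ring.
- by rewrite trmx1.
apply/matrixP=> i j; rewrite !ord1 !mxE big_ord1 !mxE eqxx mulmx1 mxtrace1.
by rewrite mulr1n mul0rn add0r.
Qed.

End Design.

(** * The systems of type E *)

(** A plain fold, so that the finite checks below can be evaluated. *)
Definition sumz (T : Type) (s : seq T) (f : T -> int) : int :=
  foldr (fun x acc => f x + acc) 0 s.

Definition dotz (s t : seq int) : int := sumz (zip s t) (fun x => x.1 * x.2).

(* Vectors of [R^8] are stored with doubled coordinates: [vecDz i j a b] encodes
   (-1)^a (e_i + (-1)^b e_j). *)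
Definition vecDz (i j : nat) (a b : bool) : seq int :=
  mkseq (fun k => (-1) ^+ a * ((k == i)%:Z + (-1) ^+ b * (k == j)%:Z) *+ 2) 8.

Definition bitseqs (n : nat) : seq bitseq :=
  iter n (fun s => [seq b :: t | b <- [:: false; true], t <- s]) [:: [::]].

Definition D8z : seq (seq int) :=
  [seq vecDz p.1 p.2 s.1 s.2 |
     p <- [seq p <- [seq (i, j) | i <- iota 0 8, j <- iota 0 8]
             | (p.1 < p.2)%N],
     s <- [seq (a, b) | a <- [:: false; true], b <- [:: false; true]]].

Definition E8z : seq (seq int) :=
  D8z ++
  [seq [seq (-1) ^+ nat_of_bool b | b <- t] |
     t <- bitseqs 8 & ~~ odd (count id t)].

Definition E7z := [seq v <- E8z | v`_6 == v`_7].
Definition E6z := [seq v <- E7z | v`_5 == v`_6].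

(* [8 - q] times the orthogonal projection onto the vectors whose coordinates
   from index [q] on are all equal: the spans of E8, E7, E6 are the cases
   q = 7, 6, 5. *)
Definition projz (q i j : nat) : int :=
  if (i < q)%N || (j < q)%N then ((8 - q) * (i == j))%:Z else 1.

(* With p the projection onto the span, the last conjunct is the degree-4 design
   identity sum x_i x_j x_k x_l = c (p_ij p_kl + p_ik p_jl + p_il p_jk), cleared
   of denominators; [e] absorbs the 3 in the denominator of c for E6. *)
Definition design4 (L : seq (seq int)) (n q K C e : nat) : bool :=
  let p := projz q in
  let I := iota 0 8 in
  let W := [seq (ij, [seq v`_(ij.1) * v`_(ij.2) | v <- L]) |
             ij <- [seq (i, j) | i <- I, j <- I]] in
  [&& uniq L,
      all (fun v => (size v == 8) && (sumz I (fun i => v`_i ^+ 2) == 8)) L,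
      all (fun i => all (fun j =>
         sumz L (fun v => v`_i * v`_j) == K%:Z * p i j) I) I,
      all (fun i => all (fun j =>
         sumz I (fun k => p i k * p k j) == (8 - q)%:Z * p i j) I) I,
      sumz I (fun i => p i i) == ((8 - q) * n)%:Z &
      all (fun x => all (fun y =>
         let: ((i, j), s) := x in let: ((k, l), t) := y in
         e%:Z * dotz s t ==
         C%:Z * (p i j * p k l + p i k * p j l + p i l * p j k)) W) W].

(** Doubled coordinates scale the second moment by 4 and the fourth by 16, so K (8 - q) = 8h and C
    (8 - q)^2 = 16 e c. The constants here and below encode h = 12, 18, 30 and c = 6, 8, 12 for E6,
    E7, E8. *)
Lemma E6z_design : design4 E6z 6 5 32 32 3.
Proof. by vm_compute. Qed.

Lemma E7z_design : design4 E7z 7 6 72 32 1.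
Proof. by vm_compute. Qed.

Lemma E8z_design : design4 E8z 8 7 240 192 1.
Proof. by vm_compute. Qed.

Lemma sumzE (T : Type) (s : seq T) (f : T -> int) :
  sumz s f = \sum_(x <- s) f x.
Proof. by elim: s => [|x s IHs] /=; rewrite ?big_nil ?big_cons // IHs. Qed.

Lemma sumz_iota (n : nat) (f : nat -> int) :
  sumz (iota 0 n) f = \sum_(i < n) f i.
Proof. by rewrite sumzE -(big_mkord xpredT f) /index_iota subn0. Qed.

Lemma dotz_map (T : Type) (s : seq T) (f g : T -> int) :
  dotz (map f s) (map g s) = \sum_(x <- s) f x * g x.
Proof.
rewrite /dotz sumzE; elim: s => [|x s IHs] /=; first by rewrite !big_nil.
by rewrite !big_cons IHs.
Qed.

(** * From the integer checks to moments over the field *)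

Section HalfIntegral.
Variable F : rcfType.

Definition vecz (v : seq int) : 'cV[F]_8 := \col_k ((v`_k)%:~R / 2).

Lemma vecz_inj (v w : seq int) :
  size v = 8%N -> size w = 8%N -> vecz v = vecz w -> v = w.
Proof.
move=> sv sw vw; apply: (@eq_from_nth _ 0) => [|i]; rewrite ?sw // sv => ltis.
have /matrixP/(_ (Ordinal ltis) 0) := vw; rewrite !mxE /=.
have n2 : (2 : F) != 0 by rewrite pnatr_eq0.
by move/(divIf n2)/eqP; rewrite eqr_int => /eqP.
Qed.

Lemma design4_system (n : nat) (R : seq 'cV[F]_n) (P : 'cV[F]_8 -> Prop)
    (L : seq (seq int)) (q K C e : nat) (d c : F) :
  design4 L n q K C e -> is_system P R ->
  (forall y, P y <-> y \in map vecz L) ->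
  (0 < n)%N -> (q < 8)%N -> (0 < K)%N -> (0 < e)%N ->
  d = (8 - q)%:R -> c = C%:R * d ^+ 2 / (16 * e%:R) ->
  4%:R * coxeter_number R = K%:R * d / 2 /\
  forall m (E : m.-tuple 'M[F]_n), orthonormal_basis E -> (0 < m)%N ->
    char_poly (gram R E) =
    ('X - (c * (2 + n%:R))%:P) * ('X - (2 * c)%:P) ^+ m.-1.
Proof.
rewrite /design4; set I := iota 0 8; set p := projz q.
case/and5P=> uL /allP normL /allP mom2 /allP projL /andP[/eqP trL mom4].
move=> sysR PL n0 q8 K0 e0 dE cE.
have inI (i : 'I_8) : (i : nat) \in I by rewrite mem_iota ltn_ord.
have d0 : d != 0 by rewrite dE pnatr_eq0 subn_eq0 -ltnNge.
have K0' : K%:R != 0 :> F by rewrite pnatr_eq0 -lt0n.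
have e0' : e%:R != 0 :> F by rewrite pnatr_eq0 -lt0n.
have uvL : uniq (map vecz L).
  rewrite map_inj_in_uniq // => v w /normL/andP[/eqP sv _]
    /normL/andP[/eqP sw _].
  exact: vecz_inj.
have [B BB RL] := is_systemP sysR uvL PL.
pose Q : 'M[F]_8 := \matrix_(i, j) ((p i j)%:~R / d).
have mom2F : \sum_(y <- map vecz L) y *m y^T = (K%:R * d / 4) *: Q.
  apply/matrixP=> i j; rewrite !mxE summxE big_map.
  have /allP/(_ j (inI j))/eqP := mom2 i (inI i); rewrite sumzE.
  move/(congr1 (intr : int -> F)); rewrite rmorphM /= rmorph_sum /= => mij.
  have -> : K%:R * d / 4 * ((p i j)%:~R / d) = K%:R * (p i j)%:~R / 4.
    by field; rewrite ?d0.
  rewrite -mij mulr_suml; apply: eq_bigr => v _.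
  by rewrite mxE big_ord1 !mxE rmorphM /=; field.
have trQ : \tr Q = n%:R.
  move: trL; rewrite sumz_iota => /(congr1 (intr : int -> F)).
  rewrite rmorph_sum /= -pmulrn natrM -dE => trL.
  apply: (mulfI d0); rewrite -trL mulr_sumr; apply: eq_bigr => i _.
  by rewrite mxE; field; rewrite ?d0.
have QQ : Q *m Q = Q.
  apply/matrixP=> i j; rewrite !mxE.
  have /allP/(_ j (inI j))/eqP := projL i (inI i); rewrite sumz_iota.
  move/(congr1 (intr : int -> F)); rewrite rmorphM /= -pmulrn -dE
    rmorph_sum /= => pij.
  apply: (mulfI d0); apply: (mulfI d0).
  transitivity (d * (p i j)%:~R); last by field; rewrite ?d0.
  rewrite -pij !mulr_sumr; apply: eq_bigr => k _; rewrite !mxE rmorphM /=.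
  by field; rewrite ?d0.
have k0 : K%:R * d / 4 != 0 by rewrite !mulf_neq0 // invr_eq0 pnatr_eq0.
have BBt := isometry_mul_tr BB RL k0 mom2F trQ QQ.
have mom4F i j a b : \sum_(y <- map vecz L) y i 0 * y j 0 * (y a 0 * y b 0) =
    c * (Q i j * Q a b + Q i a * Q j b + Q i b * Q j a).
  have inW (k l : 'I_8) : ((k : nat, l : nat), [seq v`_k * v`_l | v <- L]) \in
      [seq (ij, [seq v`_(ij.1) * v`_(ij.2) | v <- L]) |
         ij <- [seq (i, j) | i <- I, j <- I]].
    apply/mapP; exists (k : nat, l : nat) => //.
    exact: allpairs_f.
  have /allP/(_ _ (inW i j))/allP/(_ _ (inW a b))/eqP := mom4.
  rewrite dotz_map => /(congr1 (intr : int -> F)).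
  rewrite !rmorphM /= !rmorphD !rmorphM /= rmorph_sum /= => m4.
  have -> : c * (Q i j * Q a b + Q i a * Q j b + Q i b * Q j a) =
     C%:R * ((p i j)%:~R * (p a b)%:~R + (p i a)%:~R * (p j b)%:~R +
     (p i b)%:~R * (p j a)%:~R) / (16 * e%:R).
    by rewrite !mxE cE; field; rewrite ?d0 ?e0'.
  rewrite -m4 big_map mulr_sumr mulr_suml; apply: eq_bigr => v _.
  by rewrite !mxE !rmorphM /=; field; rewrite ?e0'.
split=> [|m E onbE m0].
  (* The doubled vectors have squared norm 8, so the roots themselves have squared norm 2. *)
  rewrite (coxeter_number_isometry RL mom2F trQ n0) => [|y]; first by field.
  case/mapP=> v /normL/andP[_]; rewrite sumz_iota => /eqP.
  move/(congr1 (intr : int -> F)); rewrite rmorph_sum /= => nv ->.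
  apply: (@mulfI _ 4); first by rewrite pnatr_eq0.
  transitivity (8%:R : F); last by ring.
  rewrite -[RHS]nv mulr_sumr; apply: eq_bigr => i _.
  by rewrite mxE rmorphXn /=; field.
exact: (char_poly_gram_design BB RL BBt mom4F onbE m0).
Qed.

End HalfIntegral.

Lemma mem_bitseqs (n : nat) (t : bitseq) : (t \in bitseqs n) = (size t == n).
Proof.
elim: n t => [|n IHn] t; first by case: t.
rewrite /bitseqs iterS /= cats0 mem_cat.
have cons_inj (b : bool) : injective (cons b) by move=> u v [].
case: t => [|b t].
  by apply/negbTE; rewrite negb_or; apply/andP; split; apply/mapP => -[].
rewrite eqSS -IHn; case: b; rewrite (mem_map (cons_inj _)).
  by rewrite orbC; case: (_ \in _) => //=; apply/mapP => -[].
by case: (_ \in _) => //=; apply/mapP => -[].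
Qed.

(** * The integer lists enumerate the roots of D8, E8, E7 and E6 *)

Section ExceptionalRoots.
Variable F : rcfType.

Lemma vecz_vecDz (i j : 'I_8) (a b : bool) :
  vecz F (vecDz i j a b) = (-1) ^+ a *: (bvec F i + (-1) ^+ b *: bvec F j).
Proof.
apply/matrixP=> k l; rewrite ord1 !mxE nth_mkseq // !andbT.
rewrite -mulr_natr !rmorphM !rmorphXn rmorphD rmorphM !rmorphXn rmorphN
  rmorph1 /=.
by rewrite -!pmulrn mulfK ?pnatr_eq0.
Qed.

Lemma rootD8P (y : 'cV[F]_8) :
  rootD y <-> y \in map (vecz F) D8z.
Proof.
split=> [[i [j [a [b [ij ->]]]]]|/mapP[v /allpairsP[[[i j] [a b]] []]]].
  rewrite -vecz_vecDz; apply/map_f/allpairsP.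
  exists ((i : nat, j : nat), (a, b)).
  split=> //; last by case: a; case: b.
  rewrite mem_filter [X in X && _]ij; apply: allpairs_f.
    by rewrite mem_iota ltn_ord.
  by rewrite mem_iota ltn_ord.
rewrite mem_filter => /andP[ij ijI] _ -> ->.
have [[i' j'] [Ii Ij [ei ej]]] := allpairsP ijI.
move: Ii Ij; rewrite -ei -ej !mem_iota /= => i8 j8.
exists (Ordinal i8), (Ordinal j8), a, b; split=> //.
exact: (vecz_vecDz (Ordinal i8) (Ordinal j8)).
Qed.

(** Bit i of [t] records a minus sign at position i; this carries the parity condition on [s] over
    to the enumerated bit sequences. *)
Lemma vecz_signs (s : {set 'I_8}) (t : bitseq) :
  size t = 8%N -> (forall i : 'I_8, (i \in s) = nth false t i) ->
  count id t = #|s| /\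
  vecz F [seq (-1) ^+ nat_of_bool b | b <- t] =
    \col_i ((-1) ^+ (i \in s) / 2%:R).
Proof.
move=> t8 st; split.
  have -> : t = [seq i \in s | i <- enum 'I_8].
    apply: (@eq_from_nth _ false) => [|i].
      by rewrite size_map size_enum_ord.
    rewrite t8 => i8; rewrite (nth_map (Ordinal i8)) ?size_enum_ord //.
    by rewrite st nth_enum_ord.
  by rewrite count_map cardE enumT -size_filter.
apply/matrixP=> i j; rewrite !mxE (nth_map false) ?t8 // st.
by rewrite rmorphXn rmorphN rmorph1.
Qed.

Lemma rootE8P (y : 'cV[F]_8) : rootE8 y <-> y \in map (vecz F) E8z.
Proof.
rewrite map_cat mem_cat; split.
  case=> [/rootD8P ->//|[s s_even ->]]; apply/orP; right.
  have [|i|ct <-] := @vecz_signs s [seq i \in s | i <- enum 'I_8].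
  - by rewrite size_map size_enum_ord.
  - by rewrite (nth_map i) ?size_enum_ord // nth_ord_enum.
  apply/map_f/map_f; rewrite mem_filter ct s_even mem_bitseqs size_map.
  by rewrite size_enum_ord.
case/orP=> [/rootD8P|]; first by left.
case/mapP=> v /mapP[t]; rewrite mem_filter mem_bitseqs.
move=> /andP[t_even /eqP t8] -> ->.
have [|ct ->] := @vecz_signs [set i : 'I_8 | nth false t i] t t8.
  by move=> i; rewrite inE.
by right; exists [set i : 'I_8 | nth false t i]; rewrite -?ct.
Qed.

Lemma dotc_bvecB (y : 'cV[F]_8) i j :
  dotc y (bvec F i - bvec F j) = y i 0 - y j 0.
Proof. by rewrite /dotc mulmxBr -!colE !mxE. Qed.

Lemma vecz_orth (v : seq int) i j : (i < 8)%N -> (j < 8)%N ->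
  dotc (vecz F v) (bvec F (inord i) - bvec F (inord j)) = 0 <-> v`_i == v`_j.
Proof.
move=> i8 j8; rewrite dotc_bvecB !mxE !inordK //.
rewrite -mulrBl -rmorphB /=; split=> [/eqP|/eqP->].
  by rewrite mulf_eq0 invr_eq0 pnatr_eq0 orbF intr_eq0 subr_eq0.
by rewrite subrr mul0r.
Qed.

Lemma rootE7P (y : 'cV[F]_8) : rootE7 y <-> y \in map (vecz F) E7z.
Proof.
split=> [[/rootE8P/mapP[v E8v ->] /vecz_orth vE]|/mapP[v]].
  by apply: map_f; rewrite mem_filter vE.
rewrite mem_filter => /andP[vE E8v] ->; split; last exact/vecz_orth.
exact/rootE8P/map_f.
Qed.

Lemma rootE6P (y : 'cV[F]_8) : rootE6 y <-> y \in map (vecz F) E6z.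
Proof.
split=> [[/rootE7P/mapP[v E7v ->] /vecz_orth vE]|/mapP[v]].
  by apply: map_f; rewrite mem_filter vE.
rewrite mem_filter => /andP[vE E7v] ->; split; last exact/vecz_orth.
exact/rootE7P/map_f.
Qed.

End ExceptionalRoots.

(** The eigenvalue c (n + 2), attached to the identity matrix, is identified with 4h through the
    numerical hypothesis c (2 + n) = K d / 2; the other multiplicity is dim S^n - 1. *)
Lemma Q_eigenvalues_design (F : rcfType) (n : nat) (R : seq 'cV[F]_n)
    (P : 'cV[F]_8 -> Prop) (L : seq (seq int)) (q K C e : nat) (d c : F) :
  design4 L n q K C e -> is_system P R ->
  (forall y, P y <-> y \in map (vecz F) L) ->
  (0 < n)%N -> (q < 8)%N -> (0 < K)%N -> (0 < e)%N ->
  d = (8 - q)%:R -> c = C%:R * d ^+ 2 / (16 * e%:R) ->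
  c * (2 + n%:R) = K%:R * d / 2 ->
  4%:R * coxeter_number R = K%:R * d / 2 /\
  Q_eigenvalues R [:: (4%:R * coxeter_number R, 1%N);
                      (2 * c, ((n * n.+1) %/ 2 - 1)%N)].
Proof.
move=> chk sysR PL n0 q8 K0 e0 dE cE cK.
have [cox chi] := design4_system chk sysR PL n0 q8 K0 e0 dE cE.
split=> // m E onbE; rewrite cox -cK.
have cardE := orthonormal_basis_card onbE.
rewrite chi // ?big_cons ?big_nil; last by nia.
by rewrite -cardE mulnK // subn1 expr1 mulr1.
Qed.

Theorem theorem4p1 (F : rcfType) :
  (forall (n : nat) (R : seq 'cV[F]_n),
     (1 <= n)%N -> is_system (@rootA F n) R ->
     4%:R * coxeter_number R = (4 * (n + 1))%:R /\
     Q_eigenvalues R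
       ((4%:R * coxeter_number R, 1%N) ::
        if (2 <= n)%N
        then [:: ((2 * (n + 1))%:R, n); (4%:R, ((n * (n - 1)) %/ 2 - 1)%N)]
        else [::])) /\
  (forall (n : nat) (R : seq 'cV[F]_n),
     (4 <= n)%N -> is_system (@rootD F n) R ->
     4%:R * coxeter_number R = (8 * (n - 1))%:R /\
     Q_eigenvalues R
       [:: (4%:R * coxeter_number R, 1%N);
           ((4 * (n - 2))%:R, (n - 1)%N);
           (8%:R, ((n * (n - 1)) %/ 2)%N)]) /\
  (forall R : seq 'cV[F]_6,
     is_system (@rootE6 F) R ->
     4%:R * coxeter_number R = 48%:R /\
     Q_eigenvalues R [:: (4%:R * coxeter_number R, 1%N); (12%:R, 20%N)]) /\
  (forall R : seq 'cV[F]_7,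
     is_system (@rootE7 F) R ->
     4%:R * coxeter_number R = 72%:R /\
     Q_eigenvalues R [:: (4%:R * coxeter_number R, 1%N); (16%:R, 27%N)]) /\
  (forall R : seq 'cV[F]_8,
     is_system (@rootE8 F) R ->
     4%:R * coxeter_number R = 120%:R /\
     Q_eigenvalues R [:: (4%:R * coxeter_number R, 1%N); (24%:R, 35%N)]).
Proof.
split; first by move=> n R; apply: Q_eigenvalues_rootA.
split; first by move=> n R; apply: Q_eigenvalues_rootD.
split=> [R sysR|].
  (* Throughout d = 8 - q and c = C d^2 / (16 e). For E6 this is 32 * 9 / 48 = 6, so 2c = 12 with
     multiplicity 21 - 1; E7 and E8 likewise give 16 with 28 - 1 and 24 with 36 - 1. *)
  have [||cox eig] := Q_eigenvalues_design (d := 3) (c := 6) E6z_design sysR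
    (@rootE6P F) isT isT isT isT erefl.
  - by field.
  - by field.
  split; first by rewrite cox; field.
  by rewrite (_ : 12 = 2 * 6) //; ring.
split=> [R sysR|R sysR].
  have [||cox eig] := Q_eigenvalues_design (d := 2) (c := 8) E7z_design sysR
    (@rootE7P F) isT isT isT isT erefl.
  - by field.
  - by field.
  split; first by rewrite cox; field.
  by rewrite (_ : 16 = 2 * 8) //; ring.
have [||cox eig] := Q_eigenvalues_design (d := 1) (c := 12) E8z_design sysR
  (@rootE8P F) isT isT isT isT erefl.
- by field.
- by field.
split; first by rewrite cox; field.
by rewrite (_ : 24 = 2 * 12) //; ring.
Qed.
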